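(* Let $(k_n)_{n\ge 0}$ be the sequence of positive integers with $k_0=1$ and $k_{n+1}=(2k_n)!$ for $n\ge 0$. Let $(x_i)_{i\ge 0}$ be the sequence of words over $\{0,1\}$ with $x_0=1$ and $x_{i+1}=x_ix_i0^{k_{i+1}-2k_i}$ for $i\ge 0$, and let $u=\lim_{i\to\infty}x_i$ be the infinite word having every $x_i$ as a prefix. Then the window complexity of $u$ satisfies $$\forall n\in\mathbb{N},\quad P^w_u(n)\le 4.$$
   Context: For an infinite word $u=u_0u_1u_2\cdots$, the window complexity function is $P^w_u(n)=\#\{u_{kn}u_{kn+1}\cdots u_{(k+1)n-1}: k\ge 0\}$. For a letter $x$, $x^m$ is the word made of $m$ copies of $x$. One has $|x_i|=k_i$, and each $x_i$ is a prefix of $x_{i+1}$, so the limit is well defined. *)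

(* Defs.v *)
From mathcomp Require Import all_boot.
From mathcomp Require Import boolp.

Set Implicit Arguments.
Unset Strict Implicit.
Unset Printing Implicit Defensive.

(** Infinite words over [A] are functions [nat -> A]. *)

Definition window (A : Type) (u : nat -> A) (n k : nat) : n.-tuple A :=
  [tuple u (k * n + i) | i < n].

Definition window_complexity (A : finType) (u : nat -> A) (n : nat) : nat :=
  #|[set w : n.-tuple A | `[< exists k, w = window u n k >]]|.

Definition is_prefix_of (A : Type) (w : seq A) (u : nat -> A) : Prop :=
  w = mkseq u (size w).

(** When the words [x i] have unbounded lengths, at most one [u] satisfies
    this; see [word_limit_unique]. *)
Definition is_word_limit (A : Type) (x : nat -> seq A) (u : nat -> A) : Prop :=
  forall i, is_prefix_of (x i) u.

Fixpoint kseq (n : nat) : nat :=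
  if n is n'.+1 then (2 * kseq n')`! else 1.

(** The letters 0 and 1 are [false] and [true].  The truncated subtraction is
    an exact one by [leq_double_kseq]. *)
Fixpoint xseq (i : nat) : seq bool :=
  if i is i'.+1
  then xseq i' ++ xseq i' ++ nseq (kseq i'.+1 - 2 * kseq i') false
  else [:: true].

(* Unfolding these computes factorials in unary. *)
Arguments kseq : simpl never.
Arguments xseq : simpl never.

Lemma kseq0 : kseq 0 = 1. Proof. by []. Qed.

Lemma kseqS n : kseq n.+1 = (2 * kseq n)`!. Proof. by []. Qed.

Lemma xseq0 : xseq 0 = [:: true]. Proof. by []. Qed.

Lemma xseqS i :
  xseq i.+1 = xseq i ++ xseq i ++ nseq (kseq i.+1 - 2 * kseq i) false.
Proof. by []. Qed.

Lemma kseq_gt0 n : 0 < kseq n.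
Proof. by case: n => [|n]; rewrite ?kseqS ?fact_gt0. Qed.

Lemma leq_double_kseq n : 2 * kseq n <= kseq n.+1.
Proof.
rewrite kseqS; case: (2 * kseq n) => // m.
by rewrite factS leq_pmulr // fact_gt0.
Qed.

Lemma ltn_kseq n : n < kseq n.
Proof.
elim: n => // n IHn; apply: leq_trans (leq_double_kseq n).
by rewrite mul2n -addnn -addn1 addnC leq_add // kseq_gt0.
Qed.

Lemma size_xseq i : size (xseq i) = kseq i.
Proof.
elim: i => // i IHi.
by rewrite xseqS !size_cat size_nseq IHi addnA addnn -mul2n subnKC
           ?leq_double_kseq.
Qed.

Lemma prefix_xseq i j : i <= j -> prefix (xseq i) (xseq j).
Proof.
move=> /subnK <-; elim: (j - i) => [|d IHd]; first exact: prefix_refl.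
by rewrite addSn; apply: prefix_trans IHd _; rewrite xseqS prefix_prefix.
Qed.

Lemma word_limit_exists : exists u : nat -> bool, is_word_limit xseq u.
Proof.
exists (fun n => nth false (xseq n) n) => i.
apply: (@eq_from_nth _ false) => [|m lt_m]; first by rewrite size_mkseq.
rewrite nth_mkseq //.
have lt_mm : m < size (xseq m) by rewrite size_xseq ltn_kseq.
case: (leqP i m) => [/prefix_xseq | /ltnW /prefix_xseq] /prefixP[s ->];
  by rewrite nth_cat ?lt_m ?lt_mm.
Qed.

Lemma word_limit_unique (u v : nat -> bool) :
  is_word_limit xseq u -> is_word_limit xseq v -> u =1 v.
Proof.
move=> Hu Hv n.
have lt_n : n < size (xseq n) by rewrite size_xseq ltn_kseq.
by rewrite -(nth_mkseq false u lt_n) -(Hu n) {1}(Hv n) nth_mkseq.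
Qed.

(* Main.v *)
Require Import Defs.
From mathcomp Require Import all_boot.
From mathcomp Require Import boolp zify.

Set Implicit Arguments.
Unset Strict Implicit.
Unset Printing Implicit Defensive.

(** Let [i] be least with [n <= 2 * kseq i]. Then [n] divides [kseq i.+1], so
    every window of [u] is zero or an aligned window of [xseq i.+1]. If
    [i = j.+1], the ones of [xseq i.+1] lie in two intervals of length
    [2 * kseq j < n]: the first one, starting at 0, lies in window 0, and the
    second one, starting at [kseq i], meets at most two consecutive windows.
    With the zero word this makes four; if [i = 0] then [n <= 2] and there are
    only four words of length [n]. *)

(** The padding zeros coincide with the default value [false], so a single [nth] into the second
    copy also covers the padding. *)
Lemma nth_xseqS i m :
  nth false (xseq i.+1) m =
  if m < kseq i then nth false (xseq i) m else nth false (xseq i) (m - kseq i).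
Proof.
rewrite xseqS nth_cat size_xseq; case: ifP => // _.
rewrite nth_cat size_xseq; case: ifPn => // ge_m.
by rewrite nth_nseq if_same nth_default // size_xseq leqNgt.
Qed.

Lemma nth_xseq_support i m : nth false (xseq i) m -> m < kseq i.
Proof. by rewrite -size_xseq; case: ltnP => // /(nth_default false) ->. Qed.

Lemma nth_xseqS_support i m : nth false (xseq i.+1) m -> m < 2 * kseq i.
Proof.
by rewrite nth_xseqS; case: ifP => [|_ /nth_xseq_support]; lia.
Qed.

Lemma nth_xseqSS_support i m :
  nth false (xseq i.+2) m ->
  m < 2 * kseq i \/ kseq i.+1 <= m < kseq i.+1 + 2 * kseq i.
Proof.
by rewrite nth_xseqS; case: ltnP => lt_m /nth_xseqS_support; [left | right; lia].
Qed.

Lemma dvdn_kseqS n i : 0 < n -> n <= 2 * kseq i -> n %| kseq i.+1.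
Proof. by move=> n_gt0 le_n; rewrite kseqS dvdn_fact // n_gt0. Qed.

Lemma dvdn_kseq i j : i <= j -> kseq i %| kseq j.
Proof.
elim: j => [|j IHj]; first by rewrite leqn0 => /eqP->.
rewrite leq_eqVlt ltnS => /predU1P[-> // | /IHj /dvdn_trans]; apply.
by rewrite dvdn_kseqS ?kseq_gt0 // leq_pmull.
Qed.

(** Induction on [j - i]: as [kseq i] divides [kseq j], no block straddles the border between the
    two copies of [xseq j] in [xseq j.+1]. Blocks in the padding or past the end read the default
    [false]. *)
Lemma xseq_block i j q : i <= j ->
  (forall r, r < kseq i -> nth false (xseq j) (q * kseq i + r) = false) \/
  (forall r, r < kseq i ->
     nth false (xseq j) (q * kseq i + r) = nth false (xseq i) r).
Proof.
move=> /subnK <-; elim: (j - i) q => [|d IHd] q.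
  rewrite add0n; case: q => [|q]; first by right=> r _.
  by left=> r _; rewrite nth_default // size_xseq; lia.
rewrite addSn.
have /dvdnP[c Ec] := dvdn_kseq (leq_addl d i).
have [lt_qc | le_cq] := ltnP q c.
  have E r : r < kseq i -> nth false (xseq (d + i).+1) (q * kseq i + r)
               = nth false (xseq (d + i)) (q * kseq i + r).
    move=> lt_r; rewrite nth_xseqS Ec ifT //.
    by have := leq_mul lt_qc (leqnn (kseq i)); lia.
  by case: (IHd q) => H; [left | right] => r lt_r; rewrite E ?H.
have E r : nth false (xseq (d + i).+1) (q * kseq i + r)
             = nth false (xseq (d + i)) ((q - c) * kseq i + r).
  have le_m : c * kseq i <= q * kseq i by rewrite leq_mul2r le_cq orbT.
  by rewrite nth_xseqS Ec ifF ?mulnBl; [congr nth|]; lia.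
by case: (IHd (q - c)) => H; [left | right] => r lt_r; rewrite E ?H.
Qed.

Section WordLimit.

Variables (u : nat -> bool) (hu : is_word_limit xseq u).

Lemma nth_word_limit i m : m < kseq i -> nth false (xseq i) m = u m.
Proof. by move=> lt_m; rewrite hu nth_mkseq // size_xseq. Qed.

Lemma word_limit_block i q :
  (forall r, r < kseq i -> u (q * kseq i + r) = false) \/
  (forall r, r < kseq i -> u (q * kseq i + r) = u r).
Proof.
(* Since [j < kseq j], the word [xseq j] covers block [q]. *)
pose j := i + q.+1 * kseq i.
have Eu r : r < kseq i -> u (q * kseq i + r) = nth false (xseq j) (q * kseq i + r).
  by move=> lt_r; rewrite nth_word_limit //; have := ltn_kseq j; rewrite /j; lia.
have [H | H] := xseq_block q (leq_addr _ _ : i <= j); [left | right] => r lt_r;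
  by rewrite Eu // H // nth_word_limit.
Qed.

(** With [kseq i = c * n], window [k] is the window of index [k %% c] inside block [k %/ c], and
    that block is zero or a copy of [xseq i]. *)
Lemma window_word_limit i n k : 0 < n -> n %| kseq i ->
  window u n k = [tuple false | _ < n] \/
  exists2 s, s.+1 * n <= kseq i & window u n k = window u n s.
Proof.
move=> n_gt0 /dvdnP[c Ec].
have c_gt0 : 0 < c by have := kseq_gt0 i; rewrite Ec; case: (c).
have le_s : (k %% c).+1 * n <= kseq i by rewrite Ec leq_mul2r ltn_pmod ?orbT.
have Ek (t : 'I_n) : k * n + t = (k %/ c) * kseq i + ((k %% c) * n + t).
  by rewrite {1}(divn_eq k c) Ec mulnDl mulnA addnA.
have lt_t (t : 'I_n) : (k %% c) * n + t < kseq i by have := ltn_ord t; lia.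
have [H | H] := word_limit_block i (k %/ c); [left | right; exists (k %% c) => //];
  by apply: eq_from_tnth => t; rewrite !tnth_mktuple Ek H.
Qed.

Lemma window_word_limit_cases i n k : 2 * kseq i < n <= 2 * kseq i.+1 ->
  window u n k \in [:: [tuple false | _ < n]; window u n 0;
                       window u n (kseq i.+1 %/ n);
                       window u n (kseq i.+1 %/ n).+1].
Proof.
case/andP=> lt_n le_n; rewrite !inE; set a := kseq i.+1 %/ n.
have n_gt0 : 0 < n by lia.
have [-> | [s le_s ->]] :=
  window_word_limit k n_gt0 (dvdn_kseqS n_gt0 le_n); first by rewrite eqxx.
have [-> | s_neq0] := eqVneq s 0; first by rewrite eqxx orbT.
have [-> | s_neqa] := eqVneq s a; first by rewrite eqxx !orbT.
have [-> | s_neqSa] := eqVneq s a.+1; first by rewrite eqxx !orbT.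
rewrite (_ : window u n s = [tuple false | _ < n]) ?eqxx //.
apply: eq_from_tnth => t; rewrite !tnth_mktuple; apply/negbTE/negP.
have lt_t := ltn_ord t.
(* By [le_s], window [s] lies within the prefix [xseq i.+2], whose ones are located. *)
rewrite -(@nth_word_limit i.+2); last by lia.
have Ea : kseq i.+1 = a * n + kseq i.+1 %% n by apply: divn_eq.
have lt_mod : kseq i.+1 %% n < n by rewrite ltn_mod.
have le_ns : n <= s * n by rewrite leq_pmull // lt0n.
case/nth_xseqSS_support => [|/andP[ge_m lt_m]]; first by lia.
(* A window before [a] ends by [kseq i.+1]. One after [a.+1] starts at [a.+2 * n] or later, beyond
   [kseq i.+1 + 2 * kseq i]. *)
have [lt_sa | le_as] := ltnP s a.
  by have := leq_mul lt_sa (leqnn n); lia.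
have lt_Sas : a.+1 < s by lia.
by have := leq_mul lt_Sas (leqnn n); lia.
Qed.

End WordLimit.

Lemma window_complexity_le_size (A : finType) (u : nat -> A) n
    (ws : seq (n.-tuple A)) :
  (forall k, window u n k \in ws) -> window_complexity u n <= size ws.
Proof.
move=> ws_win; apply: leq_trans (card_size ws); apply: subset_leq_card.
by apply/subsetP=> w; rewrite inE => /asboolP[k ->].
Qed.

Lemma window_complexity_le_exp (A : finType) (u : nat -> A) n :
  window_complexity u n <= #|A| ^ n.
Proof. by rewrite -card_tuple max_card. Qed.

Theorem proposition7p1 (u : nat -> bool) (hu : is_word_limit xseq u) :
  forall n : nat, window_complexity u n <= 4.
Proof.
move=> n.
have ex_i : exists i, n <= 2 * kseq i by exists n; have := ltn_kseq n; lia.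
case: (ex_minnP ex_i) => -[|i] le_n min_i.
  (* Here [n <= 2 * kseq 0 = 2], so there are at most [2 ^ 2] words. *)
  apply: leq_trans (window_complexity_le_exp u n) _.
  by rewrite card_bool (leq_pexp2l (n2 := 2)) // -(muln1 2) -kseq0.
have lt_n : 2 * kseq i < n by rewrite ltnNge; apply/negP => /min_i; rewrite ltnn.
apply: (window_complexity_le_size (ws := [:: _; _; _; _])) => k.
by apply: (window_word_limit_cases hu (i := i)); rewrite lt_n.
Qed.
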